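(* Let $\sigma,r,b$ be real parameters and consider on $\mathbb{R}^3$ the Lorenz system $$\frac{dx}{dt}=F_x=\sigma(y-x),\qquad \frac{dy}{dt}=F_y=(r-z)x-y,\qquad \frac{dz}{dt}=F_z=xy-bz.$$ This system is not a gradient system, but it is a fractional gradient system (of order $\alpha=2$) with potential function $$V(x,y,z)=\frac{1}{6}\sigma x^3-\frac12\sigma yx^2+\frac12(z-r)xy^2+\frac16y^3-\frac12xyz^2+\frac{b}{6}z^3,$$ that is, $F_x=-\mathbf{D}^2_xV$, $F_y=-\mathbf{D}^2_yV$, $F_z=-\mathbf{D}^2_zV$.
   Context: A dynamical system $dx_i/dt=F_i(x)$ on $\mathbb{R}^n$ is called a gradient system if the 1-form $\omega=\sum_iF_i\,dx_i$ is exact, $\omega=-dV$, i.e. $F_i=-\partial V/\partial x_i$ for all $i$, for some continuously differentiable function $V$. It is called a fractional gradient system of order $\alpha$ if the fractional 1-form $\omega_\alpha=\sum_iF_i(dx_i)^\alpha$ is exact, $\omega_\alpha=-d^\alpha V$ with $d^\alpha V=\sum_i(\mathbf{D}^\alpha_{x_i}V)(dx_i)^\alpha$ (the symbols $(dx_i)^\alpha$ being basis elements), i.e. $F_i=-\mathbf{D}^\alpha_{x_i}V$ for all $i$, for some continuously differentiable function $V$. Here $\mathbf{D}^\alpha_{x}$ is the Riemann–Liouville fractional derivative of order $\alpha$ with initial point $0$; for $\alpha=2$ it is the ordinary second partial derivative, $\mathbf{D}^2_{x}=\partial^2/\partial x^2$. *)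

(* Defs.v *)
From Stdlib Require Import Reals.
From mathcomp Require Import ssreflect ssrfun ssrbool eqtype ssrnat seq fintype.
From Coquelicot Require Import Coquelicot.

Set Implicit Arguments.
Unset Strict Implicit.
Unset Printing Implicit Defensive.

Local Open Scope R_scope.

(** R^n is ['I_n -> R] with Coquelicot's uniform structure on functions: its
    balls are those of the sup norm, so [continuous] below is ordinary joint
    continuity on R^n. *)
Definition vec (n : nat) : UniformSpace :=
  fct_UniformSpace 'I_n R_UniformSpace.

(** [section V p i] is t |-> V (p_0, ..., p_{i-1}, t, p_{i+1}, ...). *)
Definition section n (V : vec n -> R) (p : vec n) (i : 'I_n) (t : R) : R :=
  V (fun j => if j == i then t else p j).

Definition is_partial n (V : vec n -> R) (i : 'I_n) (p : vec n) (l : R) : Prop :=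
  is_derive (section V p i) (p i) l.

Definition continuously_differentiable n (V : vec n -> R) : Prop :=
  exists dV : 'I_n -> vec n -> R,
    (forall i p, is_partial V i p (dV i p)) /\
    (forall i p, continuous (dV i) p).

(** Coquelicot's [is_derive_n] is built on the total operator [Derive_n], which
    takes default values where a derivative does not exist; the first conjunct
    requires the lower-order derivatives to exist near x. *)
Definition has_derive_n (f : R -> R) (m : nat) (x l : R) : Prop :=
  locally x (fun y => forall k, (k < m)%N -> ex_derive_n f k y) /\
  is_derive_n f m x l.

Definition Gamma (s : R) : R :=
  RInt_gen (fun t => Rpower t (s - 1) * exp (- t))
    (at_right 0) (Rbar_locally p_infty).

(** v = (1 / Gamma(beta)) \int_0^x f(t) (x - t)^(beta - 1) dt, with the usual
    convention that the integral of order 0 is the identity.  For beta > 0 the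
    kernel is real only when x > 0, and the integral is improper at t = x. *)
Definition is_RL_integral (beta : R) (f : R -> R) (x v : R) : Prop :=
  (beta = 0 /\ v = f x) \/
  (0 < beta /\ 0 < x /\
   is_RInt_gen (fun t => f t * Rpower (x - t) (beta - 1))
     (at_point 0) (at_left x) (Gamma beta * v)).

(** Riemann-Liouville derivative with initial point 0: the m-th derivative of
    the integral of order m - alpha, where m is the least integer >= alpha. For
    alpha = m it is the ordinary m-th derivative. *)
Definition is_RL_derive (alpha : R) (f : R -> R) (x l : R) : Prop :=
  exists (m : nat) (J : R -> R),
    INR m - 1 < alpha <= INR m /\
    locally x (fun y => is_RL_integral (INR m - alpha) f y (J y)) /\
    has_derive_n J m x l.

(** Points of R at which the order-alpha derivative makes sense: all of R for
    integer alpha, the half-line to the right of the initial point otherwise. *)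
Definition RL_domain (alpha x : R) : Prop :=
  0 < x \/ exists m : nat, alpha = INR m.

Definition is_potential n (F : vec n -> vec n) (V : vec n -> R) : Prop :=
  continuously_differentiable V /\
  forall (p : vec n) (i : 'I_n), is_partial V i p (- F p i).

Definition gradient_system n (F : vec n -> vec n) : Prop :=
  exists V : vec n -> R, is_potential F V.

Definition is_fractional_potential (alpha : R) n
    (F : vec n -> vec n) (V : vec n -> R) : Prop :=
  continuously_differentiable V /\
  forall p : vec n, (forall i, RL_domain alpha (p i)) ->
  forall i : 'I_n, is_RL_derive alpha (section V p i) (p i) (- F p i).

Definition fractional_gradient_system (alpha : R) n
    (F : vec n -> vec n) : Prop :=
  exists V : vec n -> R, is_fractional_potential alpha F V.

Definition ix : 'I_3 := @Ordinal 3 0 isT.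
Definition iy : 'I_3 := @Ordinal 3 1 isT.
Definition iz : 'I_3 := @Ordinal 3 2 isT.

Definition lorenz (sigma r b : R) (p : vec 3) : vec 3 :=
  let x := p ix in let y := p iy in let z := p iz in
  fun i => match nat_of_ord i with
           | 0%nat => sigma * (y - x)
           | 1%nat => (r - z) * x - y
           | _ => x * y - b * z
           end.

Definition lorenz_potential (sigma r b : R) (p : vec 3) : R :=
  let x := p ix in let y := p iy in let z := p iz in
  1 / 6 * sigma * x ^ 3 - 1 / 2 * sigma * y * x ^ 2
  + 1 / 2 * (z - r) * x * y ^ 2 + 1 / 6 * y ^ 3
  - 1 / 2 * x * y * z ^ 2 + b / 6 * z ^ 3.

(* Main.v *)
Require Import Defs.
From Stdlib Require Import Reals.
From mathcomp Require Import ssreflect ssrfun ssrbool eqtype ssrnat seq fintype.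
From Coquelicot Require Import Coquelicot.
From Stdlib Require Import Lra FunctionalExtensionality.
Local Open Scope R_scope.

(** The Lorenz field fails the integrability condition dF_x/dz = dF_z/dx away
    from y = 0. For a potential W(x, z) = V(x, 1, z), the mixed difference
    W(1,1) - W(0,1) - W(1,0) + W(0,0) vanishes when computed along x, since F_x
    does not depend on z, but equals -1 when computed along z. *)

(** By the mean value theorem: the derivative is [c] at whichever intermediate point it returns. *)
Lemma derive_const_increment (g : R -> R) (c u v : R) :
  (forall t, is_derive g t c) -> g v - g u = c * (v - u).
Proof.
move=> dg.
have [t [_ //]] : exists t, Rmin u v <= t <= Rmax u v /\ g v - g u = c * (v - u).
apply: (MVT_gen g u v (fun=> c)) => t _; first exact: dg.
apply/continuity_pt_filterlim; apply: ex_derive_continuous.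
by exists c; exact: dg.
Qed.

(** [is_partial] differentiates a section only at the point's own coordinate. Moving the point along
    axis [i] leaves the section unchanged, which gives the derivative at every [t]. *)
Lemma potential_section_derive n (F : vec n -> vec n) (V : vec n -> R)
    (p : vec n) (i : 'I_n) (t : R) :
  is_potential F V ->
  is_derive (section V p i) t (- F (fun j => if j == i then t else p j) i).
Proof.
move=> [_ dV]; have := dV (fun j => if j == i then t else p j) i.
rewrite /is_partial eqxx; apply: is_derive_ext => s; congr (V _).
by apply: functional_extensionality => j; case: (j == i).
Qed.

Definition plane_point (x z : R) : vec 3 :=
  fun j => match nat_of_ord j with 0%nat => x | 1%nat => 1 | _ => z end.

Lemma section_plane_x V x z t : section V (plane_point x z) ix t = V (plane_point t z).
Proof. by congr (V _); apply: functional_extensionality => -[[|[|[|]]] ?]. Qed.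

Lemma section_plane_z V x z t : section V (plane_point x z) iz t = V (plane_point x t).
Proof. by congr (V _); apply: functional_extensionality => -[[|[|[|]]] ?]. Qed.

Lemma lorenz_not_gradient (sigma r b : R) : ~ gradient_system (lorenz sigma r b).
Proof.
move=> [V potV].
have dx x z : is_derive (fun t => V (plane_point t z)) x (- (sigma * (1 - x))).
  apply: (is_derive_ext _ _ _ _ (section_plane_x V x z)).
  exact: potential_section_derive potV.
have dz x z : is_derive (fun t => V (plane_point x t)) z (- (x * 1 - b * z)).
  apply: (is_derive_ext _ _ _ _ (section_plane_z V x z)).
  exact: potential_section_derive potV.
have hx : V (plane_point 1 1) - V (plane_point 1 0) -
    (V (plane_point 0 1) - V (plane_point 0 0)) = 0 * (1 - 0).
  apply: (derive_const_increment
    (fun t => V (plane_point t 1) - V (plane_point t 0))) => t.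
  (* The derivative 0 is a difference of two equal x-derivatives, one for each term. *)
  rewrite -(Rminus_diag (- (sigma * (1 - t)))).
  exact: (is_derive_minus (K := R_AbsRing) (V := R_NormedModule)).
have hz : V (plane_point 1 1) - V (plane_point 0 1) -
    (V (plane_point 1 0) - V (plane_point 0 0)) = -1 * (1 - 0).
  apply: (derive_const_increment
    (fun t => V (plane_point 1 t) - V (plane_point 0 t))) => t.
  have -> : -1 = - (1 * 1 - b * t) - - (0 * 1 - b * t) by ring.
  exact: (is_derive_minus (K := R_AbsRing) (V := R_NormedModule)).
(* [hx] and [hz] group the same four values differently, so 0 = -1. *)
lra.
Qed.

(** For order 2 take m = 2: the integral has order 0, so [J] is [f] itself and only the ordinary
    second derivative remains. *)
Lemma is_RL_derive_2 (f f' : R -> R) (x l : R) :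
  (forall t, is_derive f t (f' t)) -> is_derive f' x l -> is_RL_derive 2 f x l.
Proof.
move=> df df'; exists 2%nat, f; split; first by simpl; lra.
split; first by apply: filter_forall => y; left; split=> //=; lra.
split.
  apply: filter_forall => y [|[|//]] _ //=.
  by exists (f' y).
apply: is_derive_ext df' => t /=.
(* The total operator [Derive] agrees with [f'] because [f] is differentiable everywhere. *)
by symmetry; apply: is_derive_unique.
Qed.

(** A sup-norm ball bounds every coordinate with the same radius. *)
Lemma continuous_coord n (i : 'I_n) (p : vec n) : continuous (fun q : vec n => q i) p.
Proof. by move=> P [e He]; exists e => q Hq; apply: He; exact: Hq. Qed.

Lemma continuous_Rplus (T : UniformSpace) (f g : T -> R) (x : T) :
  continuous f x -> continuous g x -> continuous (fun y => f y + g y) x.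
Proof. exact: (continuous_plus (K := R_AbsRing) (V := R_NormedModule)). Qed.

Lemma continuous_Rminus (T : UniformSpace) (f g : T -> R) (x : T) :
  continuous f x -> continuous g x -> continuous (fun y => f y - g y) x.
Proof. exact: (continuous_minus (K := R_AbsRing) (V := R_NormedModule)). Qed.

Lemma continuous_Rmult (T : UniformSpace) (f g : T -> R) (x : T) :
  continuous f x -> continuous g x -> continuous (fun y => f y * g y) x.
Proof. exact: (continuous_mult (K := R_AbsRing)). Qed.

(** Squares are written as products so that continuity splits into sums, differences and products of
    coordinates. *)
Definition lorenz_potential_grad (sigma r b : R) (i : 'I_3) (p : vec 3) : R :=
  let x := p ix in let y := p iy in let z := p iz in
  match nat_of_ord i with
  | 0%nat => 1 / 2 * sigma * (x * x) - sigma * y * x + 1 / 2 * (z - r) * (y * y)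
             - 1 / 2 * y * (z * z)
  | 1%nat => (z - r) * x * y + 1 / 2 * (y * y) - 1 / 2 * sigma * (x * x)
             - 1 / 2 * x * (z * z)
  | _ => 1 / 2 * x * (y * y) - x * y * z + b / 2 * (z * z)
  end.

(** Stated at every [t], since the first derivative is differentiated again along the same
    section. *)
Lemma lorenz_potential_partial (sigma r b : R) (i : 'I_3) (p : vec 3) (t : R) :
  is_derive (section (lorenz_potential sigma r b) p i) t
    (section (lorenz_potential_grad sigma r b i) p i t).
Proof.
case: i => -[|[|[|//]]] ?;
  rewrite /section /lorenz_potential /lorenz_potential_grad /=;
  by auto_derive => //; field.
Qed.

Lemma lorenz_potential_partial2 (sigma r b : R) (i : 'I_3) (p : vec 3) :
  is_derive (section (lorenz_potential_grad sigma r b i) p i) (p i)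
    (- lorenz sigma r b p i).
Proof.
case: i => -[|[|[|//]]] h; set i := Ordinal h.
(* [i] and [ix] may carry different bound proofs; identifying them makes [p i] and [p ix] the same
   term. *)
- have -> : i = ix by exact: val_inj.
  rewrite /section /lorenz_potential_grad /lorenz /=; auto_derive => //; field.
- have -> : i = iy by exact: val_inj.
  rewrite /section /lorenz_potential_grad /lorenz /=; auto_derive => //; field.
- have -> : i = iz by exact: val_inj.
  rewrite /section /lorenz_potential_grad /lorenz /=; auto_derive => //; field.
Qed.

Lemma lorenz_potential_C1 (sigma r b : R) :
  continuously_differentiable (lorenz_potential sigma r b).
Proof.
exists (lorenz_potential_grad sigma r b); split=> i p.
  have := lorenz_potential_partial sigma r b i p (p i).
  rewrite {2}/section.
  (* Overwriting a coordinate by its own value gives back [p]. *)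
  suff -> : (fun j => if j == i then p i else p j) = p by [].
  by apply: functional_extensionality => j; case: eqP => [->|].
case: i => -[|[|[|//]]] ?; rewrite /lorenz_potential_grad /=;
  repeat first [ exact: continuous_coord | exact: continuous_const
    | apply: continuous_Rminus | apply: continuous_Rplus | apply: continuous_Rmult ].
Qed.

Lemma lorenz_fractional_potential (sigma r b : R) :
  is_fractional_potential 2 (lorenz sigma r b) (lorenz_potential sigma r b).
Proof.
split; first exact: lorenz_potential_C1.
move=> p _ i; apply: is_RL_derive_2.
  exact: lorenz_potential_partial.
exact: lorenz_potential_partial2.
Qed.

Theorem mainTheorem4 (sigma r b : R) :
  ~ gradient_system (lorenz sigma r b) /\
  fractional_gradient_system 2 (lorenz sigma r b) /\
  is_fractional_potential 2 (lorenz sigma r b) (lorenz_potential sigma r b).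
Proof.
split; first exact: lorenz_not_gradient.
split; last exact: lorenz_fractional_potential.
by exists (lorenz_potential sigma r b); exact: lorenz_fractional_potential.
Qed.
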